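(* Let $G$ be a simple graph of order $n$ and let $v\in V(G)$ be a vertex of degree $d_v$. For every $\alpha\in[0,1)$ and $k\in[0,d_v+1]$, $$\rho_{\alpha}^2(G)-(\rho_{\alpha}(G-v)+\alpha)^2\le (1-\alpha)^2\left(2d_v-1+\frac{\alpha d_v(n+d_v-1)+(k-2)(d_v-\rho_{\alpha}(G))}{\rho_{\alpha}(G)-\alpha d_v}\right).$$ If $G$ is connected, the equality holds if and only if either $G\cong K_n$, or $G\cong K_{1,n-1}$ when $\alpha=0$, $d_v=1$ and $k=2$.
   Context: For a simple graph $G$ with adjacency matrix $A(G)$ and diagonal matrix of vertex degrees $D(G)$, and for real $\alpha\in[0,1]$, put $A_\alpha(G)=\alpha D(G)+(1-\alpha)A(G)$; $\rho_\alpha(G)$ denotes the largest eigenvalue of $A_\alpha(G)$. $V(G)$ is the vertex set of $G$, and the order of $G$ is $|V(G)|$. $G-v$ is the graph obtained from $G$ by deleting the vertex $v$ and all edges incident to $v$. $K_n$ is the complete graph on $n$ vertices and $K_{1,n-1}$ is the star on $n$ vertices. *)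

(* Defs.v *)
From mathcomp Require Import all_boot all_order all_algebra.
From mathcomp Require Import classical_sets reals.

Set Implicit Arguments.
Unset Strict Implicit.
Unset Printing Implicit Defensive.

Import Order.TTheory GRing.Theory Num.Theory.
Local Open Scope ring_scope.

Record sgraph := SGraph {
  vertex :> finType;
  edge : rel vertex;
  edge_sym : symmetric edge;
  edge_irr : irreflexive edge
}.

Definition degree (G : sgraph) (v : G) : nat := #|[pred u | edge v u]|.

Definition connected (G : sgraph) : Prop := forall x y : G, connect (@edge G) x y.

Definition isomorphic (G H : sgraph) : Prop :=
  exists2 f : G -> H, bijective f & forall x y : G, edge (f x) (f y) = edge x y.

Section VertexDeletion.
Variables (G : sgraph) (v : G).

Definition del_edge : rel {u : G | u != v} := fun x y => edge (val x) (val y).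

Fact del_edge_sym : symmetric del_edge.
Proof. by move=> x y; rewrite /del_edge edge_sym. Qed.

Fact del_edge_irr : irreflexive del_edge.
Proof. by move=> x; rewrite /del_edge edge_irr. Qed.

Definition del_vertex : sgraph := SGraph del_edge_sym del_edge_irr.
End VertexDeletion.

Section CompleteGraph.
Variable n : nat.

Definition complete_edge : rel 'I_n := fun i j => i != j.

Fact complete_edge_sym : symmetric complete_edge.
Proof. by move=> i j; rewrite /complete_edge eq_sym. Qed.

Fact complete_edge_irr : irreflexive complete_edge.
Proof. by move=> i; rewrite /complete_edge eqxx. Qed.

Definition complete_graph : sgraph := SGraph complete_edge_sym complete_edge_irr.
End CompleteGraph.

Section CompleteBipartiteGraph.
Variables m n : nat.

Definition bipartite_edge : rel ('I_m + 'I_n) := fun x y =>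
  match x, y with
  | inl _, inr _ | inr _, inl _ => true
  | _, _ => false
  end.

Fact bipartite_edge_sym : symmetric bipartite_edge.
Proof. by move=> [i|i] [j|j]. Qed.

Fact bipartite_edge_irr : irreflexive bipartite_edge.
Proof. by move=> [i|i]. Qed.

Definition complete_bipartite_graph : sgraph :=
  SGraph bipartite_edge_sym bipartite_edge_irr.
End CompleteBipartiteGraph.

Section AlphaMatrix.
Variables (R : realType) (G : sgraph).

Definition adjacency_mx : 'M[R]_#|G| :=
  \matrix_(i, j) (edge (enum_val i) (enum_val j))%:R.

Definition degree_mx : 'M[R]_#|G| :=
  diag_mx (\row_i (degree (enum_val i))%:R).

Definition alpha_mx (alpha : R) : 'M[R]_#|G| :=
  alpha *: degree_mx + (1 - alpha) *: adjacency_mx.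

(* The eigenvalues of a real symmetric matrix of positive order form a finite
   nonempty set of reals, so this supremum is the largest eigenvalue.  For the
   graph without vertices it takes the junk value 0. *)
Definition rho (alpha : R) : R :=
  sup [set a : R | eigenvalue (alpha_mx alpha) a]%classic.
End AlphaMatrix.

(* Main.v *)
Require Import Defs.
From mathcomp Require Import all_boot all_order all_algebra perm.
From mathcomp Require Import classical_sets reals.
From mathcomp Require Import ring lra.

(** Write [r] for the spectral radius of [G], [d] for the degree of [v], [b] for
    the indicator function of the neighbourhood [N] of [v], [M] for the matrix
    of [G] with the row and the column of [v] set to zero, and
    [s = rho (G - v) + alpha].

    Deleting [v] lowers the degree of each neighbour by one, so off [v] the
    matrix [M] is the matrix of [G - v] plus [alpha] times a diagonal 0-1 matrix.
    So its eigenvalues are at most [s], and at least [-s] because its entries are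
    nonnegative.
    Eliminating the other coordinates from the eigenvalue equation at [v] gives
      [r - alpha d = (1 - alpha)^2 <b, (r - M)^-1 b>].
    If [r > s], each eigenvalue [m] of [M] satisfies
      [1 / (r - m) = (r + m) / (r^2 - m^2) <= (r + m) / (r^2 - s^2)], whence
      [(r - alpha d) (r^2 - s^2) <= (1 - alpha)^2 (r d + <bM, b>)];
    if [r <= s] this is clear from the signs ([deletion_bound]).

    The right-hand side of the theorem, times [r - alpha d], is [(1 - alpha)^2]
    times a numerator that is affine in [k], so it remains to compare
    [r d + <bM, b>] with the numerator at both ends of the range of [k]:
    - at [k = 0] by the Rayleigh inequality for the indicator function of the
      closed neighbourhood of [v] ([rayleigh_closed_nbr]);
    - at [k = d + 1] by counting: a degree is at most [n - 1], and a vertex of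
      [N] has at most [d - 1] neighbours in [N] ([quad_nbr_le]).

    Equality in a connected graph with [k < d + 1] forces equality at [k = 0].
    Then the indicator function of the closed neighbourhood is a Perron
    eigenfunction, hence positive everywhere, so it is constant and [G] is
    regular of degree [n - 1] ([complete_of_eigenfun]).
    Equality with [k = d + 1] makes [N] a clique, and equality in
    [deletion_bound] gives [b M^2 = s^2 b]: no walk of two steps of [M] leads
    from [N] to a vertex outside the closed neighbourhood of [v]. If there are
    such vertices, connectedness provides one adjacent to [N]; a step along the
    diagonal, or inside the clique, followed by that edge would be such a walk
    unless [alpha = 0] and [d = 1], and then [G] is a star around the neighbour
    of [v] ([complete_or_star]).

    For the converse the radii of complete graphs and of stars are read off
    from positive eigenfunctions ([rho_of_pos_eigenfun]). *)

Set Implicit Arguments.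
Unset Strict Implicit.
Unset Printing Implicit Defensive.

Import Order.TTheory GRing.Theory Num.Theory.
Local Open Scope ring_scope.

(** * Symmetric forms on row vectors *)

Definition dot {R : pzRingType} {n : nat} (u v : 'rV[R]_n) : R :=
  \sum_i u 0 i * v 0 i.

Section Dot.
Variables (R : realFieldType) (n : nat).
Implicit Types (u v w z : 'rV[R]_n) (A : 'M[R]_n).

Lemma dotC u v : dot u v = dot v u.
Proof. by apply: eq_bigr => i _; rewrite mulrC. Qed.

Lemma dotDl u v w : dot (u + v) w = dot u w + dot v w.
Proof. by rewrite -big_split; apply: eq_bigr => i _; rewrite mxE mulrDl. Qed.

Lemma dotZl a u v : dot (a *: u) v = a * dot u v.
Proof. by rewrite mulr_sumr; apply: eq_bigr => i _; rewrite mxE mulrA. Qed.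

Lemma dotNl u v : dot (- u) v = - dot u v.
Proof. by rewrite -scaleN1r dotZl mulN1r. Qed.

Lemma dotDr u v w : dot u (v + w) = dot u v + dot u w.
Proof. by rewrite dotC dotDl !(dotC u). Qed.

Lemma dotZr a u v : dot u (a *: v) = a * dot u v.
Proof. by rewrite dotC dotZl (dotC u). Qed.

Lemma dotNr u v : dot u (- v) = - dot u v.
Proof. by rewrite dotC dotNl (dotC u). Qed.

Definition dotE := (dotDl, dotNl, dotZl, dotDr, dotNr, dotZr).

Lemma dot_ge0 u : 0 <= dot u u.
Proof. by apply: sumr_ge0 => i _; rewrite -expr2 sqr_ge0. Qed.

Lemma dot_eq0 u : dot u u = 0 -> u = 0.
Proof.
move=> /eqP; rewrite psumr_eq0 => [/allP u0|i _]; last by rewrite -expr2 sqr_ge0.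
apply/rowP => i; have /eqP := u0 i (mem_index_enum i).
by rewrite -expr2 mxE => /eqP; rewrite sqrf_eq0 => /eqP.
Qed.

Lemma dot_mxl A u v : dot (u *m A) v = \sum_i \sum_j u 0 i * A i j * v 0 j.
Proof.
rewrite exchange_big; apply: eq_bigr => j _ /=.
by rewrite mxE mulr_suml.
Qed.

Lemma dot_mx_sym A u v : A^T = A -> dot (u *m A) v = dot u (v *m A).
Proof.
move=> symA; rewrite dot_mxl dotC dot_mxl exchange_big.
apply: eq_bigr => i _; apply: eq_bigr => j _.
by rewrite -[in LHS]symA mxE; ring.
Qed.

(** A nonnegative quadratic polynomial in [t], here the form at [u + t v], has a
    nonpositive discriminant. *)
Lemma psd_cauchy_schwarz A u v : A^T = A ->
  (forall z, 0 <= dot (z *m A) z) ->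
  dot (u *m A) v ^+ 2 <= dot (u *m A) u * dot (v *m A) v.
Proof.
move=> symA psdA.
have disc t : 0 <= dot (u *m A) u + 2 * t * dot (u *m A) v
                   + t ^+ 2 * dot (v *m A) v.
  have := psdA (u + t *: v).
  rewrite mulmxDl -scalemxAl !dotE (dot_mx_sym v u symA) (dotC v).
  by lra.
have [v0|v0] := eqVneq (dot (v *m A) v) 0.
  rewrite v0 mulr0; have [->|c0] := eqVneq (dot (u *m A) v) 0.
    by rewrite expr0n.
  have := disc (- (dot (u *m A) u + 1) / (2 * dot (u *m A) v)).
  rewrite v0 mulr0 addr0.
  have -> : dot (u *m A) u + 2 * (- (dot (u *m A) u + 1) /
      (2 * dot (u *m A) v)) * dot (u *m A) v = -1 by field.
  by rewrite ler0N1.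
have vpos : 0 < dot (v *m A) v by rewrite lt0r v0 psdA.
have := disc (- dot (u *m A) v / dot (v *m A) v).
rewrite -(ler_pM2r vpos) mul0r.
have -> : (dot (u *m A) u + 2 * (- dot (u *m A) v / dot (v *m A) v) *
   dot (u *m A) v + (- dot (u *m A) v / dot (v *m A) v) ^+ 2 *
   dot (v *m A) v) * dot (v *m A) v =
   dot (u *m A) u * dot (v *m A) v - dot (u *m A) v ^+ 2 by field.
by rewrite subr_ge0.
Qed.

(** Cauchy-Schwarz for the pair [u], [u A] bounds [|u A|^4] by zero. This is how
    equality in a Rayleigh inequality produces an eigenvector. *)
Lemma psd_isotropic A u : A^T = A -> (forall z, 0 <= dot (z *m A) z) ->
  dot (u *m A) u = 0 -> u *m A = 0.
Proof.
move=> symA psdA u0; apply: dot_eq0; apply/eqP.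
rewrite -sqrf_eq0 eq_le sqr_ge0 andbT.
by apply: le_trans (psd_cauchy_schwarz _ _ symA psdA) _; rewrite u0 mul0r.
Qed.

(** A crude bound for the quadratic form of [A]; the summand 1 keeps it
    positive. *)
Definition entry_bound A : R := 1 + \sum_i \sum_j `|A i j|.

Lemma entry_bound_gt0 A : 0 < entry_bound A.
Proof.
by rewrite ltr_pwDl// sumr_ge0// => i _; rewrite sumr_ge0// => j _; rewrite normr_ge0.
Qed.

Lemma coord_le_dot u i : u 0 i ^+ 2 <= dot u u.
Proof.
rewrite /dot (bigD1 i)//= -expr2 lerDl sumr_ge0// => j _.
by rewrite -expr2 sqr_ge0.
Qed.

Lemma form_bound A u : dot (u *m A) u <= entry_bound A * dot u u.
Proof.
rewrite dot_mxl mulrDl mul1r -[leLHS]add0r lerD ?dot_ge0// mulr_suml.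
apply: ler_sum => i _; rewrite mulr_suml; apply: ler_sum => j _.
apply: le_trans (ler_norm _) _; rewrite !normrM mulrAC mulrC.
apply: ler_wpM2l => //.
have := coord_le_dot u i; have := coord_le_dot u j.
rewrite -(real_normK (num_real (u 0 i))) -(real_normK (num_real (u 0 j))).
have := sqr_ge0 (`|u 0 i| - `|u 0 j|); nra.
Qed.

Lemma sub_scalar_form A t u :
  dot (u *m (t%:M - A)) u = t * dot u u - dot (u *m A) u.
Proof. by rewrite mulmxBr mul_mx_scalar !dotE. Qed.

Lemma sub_scalar_sym A t : A^T = A -> (t%:M - A)^T = t%:M - A.
Proof. by rewrite linearB /= tr_scalar_mx => ->. Qed.

Lemma rayleigh_eq A t u : A^T = A ->
  (forall z, dot (z *m A) z <= t * dot z z) ->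
  dot (u *m A) u = t * dot u u -> u *m A = t *: u.
Proof.
move=> symA le_t eq_t.
have /eqP : u *m (t%:M - A) = 0.
  apply: psd_isotropic => [|z|]; first exact: sub_scalar_sym.
    by rewrite sub_scalar_form subr_ge0.
  by rewrite sub_scalar_form eq_t subrr.
by rewrite mulmxBr mul_mx_scalar subr_eq0 => /eqP.
Qed.

(** Cauchy-Schwarz for [z] and [z A^-1] reads
    [|z|^4 <= <zA, z> <z A^-1, z>], and the last factor is at most a constant
    times [|z|^2]. This replaces the compactness of the sphere in the proof of
    [top_eigenvalue]. *)
Lemma pd_coercive A : A^T = A -> A \in unitmx ->
  (forall z, 0 <= dot (z *m A) z) ->
  forall z, dot z z / entry_bound (invmx A) <= dot (z *m A) z.
Proof.
move=> symA unitA psdA z; rewrite ler_pdivrMr ?entry_bound_gt0//.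
have [->|z0] := eqVneq (dot z z) 0.
  by rewrite mulr_ge0// ltW// entry_bound_gt0.
have zpos : 0 < dot z z by rewrite lt0r z0 dot_ge0.
rewrite -(ler_pM2r zpos) -expr2 -mulrA.
have := psd_cauchy_schwarz z (z *m invmx A) symA psdA.
rewrite dot_mx_sym// mulmxKV// => /le_trans; apply.
by rewrite ler_wpM2l// dotC form_bound.
Qed.

(** The spectrum of [A] lies in [[-s, s]], so that of [A^2] lies below [s^2].
    Without diagonalizing, polarize: [<t z A, z A>] is a difference of values of
    the form of [A] at [t z + z A] and [t z - z A]; then take [t = s]. *)
Lemma contraction_sqr A s z : A^T = A -> 0 <= s ->
  (forall u, `|dot (u *m A) u| <= s * dot u u) ->
  dot (z *m A) (z *m A) <= s ^+ 2 * dot z z.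
Proof.
move=> symA s0 bA.
have pol t : 2 * t * dot (z *m A) (z *m A) <=
     s * (t ^+ 2 * dot z z + dot (z *m A) (z *m A)).
  have := bA (t *: z + z *m A); have := bA (t *: z - z *m A).
  rewrite !mulmxDl mulNmx -!scalemxAl !dotE (dotC _ z).
  rewrite (dot_mx_sym (z *m A) z)//.
  by rewrite !ler_norml => /andP[P1 P2] /andP[P3 P4]; nra.
have [s_eq0|sn0] := eqVneq s 0.
  by have := pol 1; rewrite s_eq0; lra.
have sp : 0 < s by rewrite lt0r sn0.
by rewrite -(ler_pM2l sp); have := pol s; lra.
Qed.

(** The inequality [<b, (r - A)^-1 b> <= <b, (r + A) b> / (r^2 - s^2)], valid
    because [1 / (r - m) <= (r + m) / (r^2 - s^2)] for [|m| <= s]. Writing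
    [b = y (r - A)] turns it into the nonnegativity of the form of
    [(s^2 - A^2) (r - A)] at [y], which splits as
    [(r - s) (s^2 - A^2) + (s - A) (s + A) (s - A)], both nonnegative. In case of
    equality [y], hence [b], is in the kernel of [s^2 - A^2]. *)
Lemma resolvent_bound A s r y (b := r *: y - y *m A) :
  A^T = A -> 0 <= s -> s < r ->
  (forall z, `|dot (z *m A) z| <= s * dot z z) ->
  (r ^+ 2 - s ^+ 2) * dot b y <= r * dot b b + dot (b *m A) b /\
  ((r ^+ 2 - s ^+ 2) * dot b y = r * dot b b + dot (b *m A) b ->
   b *m A *m A = s ^+ 2 *: b).
Proof.
move=> symA s0 sr bA.
pose w := s *: y - y *m A.
have psd_w : 0 <= s * dot w w + dot (w *m A) w.
  by have := bA w; rewrite ler_norml => /andP[+ _]; lra.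
have a2 := contraction_sqr y symA s0 bA.
have key : r * dot b b + dot (b *m A) b - (r ^+ 2 - s ^+ 2) * dot b y =
    (r - s) * (s ^+ 2 * dot y y - dot (y *m A) (y *m A)) +
    (s * dot w w + dot (w *m A) w).
  rewrite /b /w !mulmxBl -!scalemxAl !dotE.
  rewrite (dotC y (y *m A)) (dot_mx_sym (y *m A) y)//.
  by ring.
have sr0 : 0 < r - s by rewrite subr_gt0.
split; first by rewrite -subr_ge0 key addr_ge0// mulr_ge0 ?subr_ge0// ltW.
move=> /esym/eqP; rewrite -subr_eq0 key.
rewrite paddr_eq0 ?mulr_ge0 ?subr_ge0// ?(ltW sr)//.
rewrite mulf_eq0 gt_eqF//= subr_eq0 => /andP[/eqP eqy _].
have yAA : y *m (A *m A) = s ^+ 2 *: y.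
  apply: rayleigh_eq => [|z|].
  - by rewrite trmx_mul symA.
  - by rewrite mulmxA dot_mx_sym// contraction_sqr.
  - by rewrite mulmxA dot_mx_sym.
rewrite /b !mulmxBl -!scalemxAl -(mulmxA y A A) yAA.
by rewrite -!scalemxAl scalerBr !scalerA mulrC.
Qed.

End Dot.

(** * The largest eigenvalue of a symmetric matrix *)

(** The infimum [l] of the upper bounds of the Rayleigh quotient is itself such a
    bound, so every eigenvalue is at most [l]. If [l] were no eigenvalue, [l - A]
    would be positive definite, hence coercive, and [l] could be lowered. *)
Lemma top_eigenvalue (R : realType) (n : nat) (A : 'M[R]_n) :
  (0 < n)%N -> A^T = A ->
  let t := sup [set a : R | eigenvalue A a]%classic in
  eigenvalue A t /\ forall z, dot (z *m A) z <= t * dot z z.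
Proof.
move=> n0 symA.
pose S := [set t : R | forall z, dot (z *m A) z <= t * dot z z]%classic.
pose l := inf S.
have nz_dot (z : 'rV[R]_n) : z != 0 -> 0 < dot z z.
  move=> z0; rewrite lt0r dot_ge0 andbT.
  by apply: contraNneq z0 => /dot_eq0 ->.
have lbS z : z != 0 -> lbound S (dot (z *m A) z / dot z z).
  by move=> z0 t St /=; rewrite ler_pdivrMr ?nz_dot.
have S0 : (S !=set0)%classic by exists (entry_bound A) => z; exact: form_bound.
have S_l : S l.
  move=> z; have [->|z0] := eqVneq z 0.
    by rewrite mul0mx -[0](scale0r 0) !dotE !mul0r mulr0.
  by rewrite -ler_pdivrMr ?nz_dot// lb_le_inf//; exact: lbS.
have hlS : has_lbound S.
  have e0 : (\row_i 1 : 'rV[R]_n) != 0.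
    apply/eqP => /rowP /(_ (Ordinal n0)); rewrite !mxE => /eqP.
    by rewrite oner_eq0.
  by eexists; apply: lbS e0.
have eig_l : eigenvalue A l.
  apply: contraT => /eigenvalueP no_eig.
  have unitB : l%:M - A \in unitmx.
    rewrite -row_free_unit; apply: inj_row_free => u /eqP.
    rewrite mulmxBr mul_mx_scalar subr_eq0 => /eqP uA.
    have [//|u0] := eqVneq u 0.
    by case: no_eig; exists u.
  have psdB z : 0 <= dot (z *m (l%:M - A)) z.
    by rewrite sub_scalar_form subr_ge0.
  have coer := pd_coercive (sub_scalar_sym l symA) unitB psdB.
  have K0 := entry_bound_gt0 (invmx (l%:M - A)).
  (* coercivity leaves room to lower the infimum *)
  have : S (l - (entry_bound (invmx (l%:M - A)))^-1).
    move=> z; have := coer z; rewrite sub_scalar_form.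
    by rewrite mulrBl [_^-1 * _]mulrC; lra.
  move=> /(ge_inf hlS); rewrite -/l.
  by have := K0; rewrite -invr_gt0; lra.
have -> : sup [set a : R | eigenvalue A a]%classic = l.
  have ub_l : ubound [set a : R | eigenvalue A a]%classic l.
    move=> a /= /eigenvalueP[z zA z0].
    by have := S_l z; rewrite zA dotZl ler_pM2r ?nz_dot.
  apply/eqP; rewrite eq_le ge_sup//=; last by exists l.
  by rewrite ub_le_sup//; exists l.
by split.
Qed.

(** * Kernels on a finite type and the matrix of a graph *)

Section Kernels.
Variables (R : realFieldType) (T : finType).
Implicit Types (f g : T -> R) (a : T -> T -> R).

(** Vectors and matrices over the enumeration of [T] stand for functions and
    kernels on [T]; all arguments about graphs are made on the latter. *)
Definition vec f : 'rV[R]_#|T| := \row_i f (enum_val i).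

Definition kernel_mx a : 'M[R]_#|T| :=
  \matrix_(i, j) a (enum_val i) (enum_val j).

Definition quad a f : R := \sum_x \sum_y f x * a x y * f y.

Lemma sum_enum_val f : \sum_i f (enum_val (i : 'I_#|T|)) = \sum_x f x.
Proof. by rewrite [RHS](big_enum_val (A := T)). Qed.

Lemma vecP (z : 'rV[R]_#|T|) : exists f, z = vec f.
Proof.
by exists (fun x => z 0 (enum_rank x)); apply/rowP => i; rewrite mxE enum_valK.
Qed.

Lemma dot_vec f g : dot (vec f) (vec g) = \sum_x f x * g x.
Proof. by rewrite -sum_enum_val; apply: eq_bigr => i _; rewrite !mxE. Qed.

Lemma vec_kernel f a : vec f *m kernel_mx a = vec (fun x => \sum_y f y * a y x).
Proof.
apply/rowP => j; rewrite !mxE -sum_enum_val.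
by apply: eq_bigr => i _; rewrite !mxE.
Qed.

Lemma quad_act a f : quad a f = \sum_x f x * \sum_y f y * a y x.
Proof.
rewrite /quad exchange_big; apply: eq_bigr => x _.
by rewrite mulr_sumr; apply: eq_bigr => y _; rewrite mulrC.
Qed.

Lemma dot_kernel f a : dot (vec f *m kernel_mx a) (vec f) = quad a f.
Proof.
by rewrite vec_kernel dot_vec quad_act; apply: eq_bigr => x _; rewrite mulrC.
Qed.

Lemma kernel_mx_sym a : (forall x y, a x y = a y x) ->
  (kernel_mx a)^T = kernel_mx a.
Proof. by move=> syma; apply/matrixP => i j; rewrite !mxE syma. Qed.

Lemma quad_abs a f : (forall x y, 0 <= a x y) ->
  `|quad a f| <= quad a (fun x => `|f x|).
Proof.
move=> a0; apply: le_trans (ler_norm_sum _ _ _) _; apply: ler_sum => x _.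
apply: le_trans (ler_norm_sum _ _ _) _; apply: ler_sum => y _.
by rewrite !normrM (ger0_norm (a0 x y)).
Qed.

End Kernels.

Section AlphaKernel.
Variables (R : realType) (G : sgraph) (alpha : R).
Implicit Types (f g : G -> R).

Definition alpha_ker (x y : G) : R :=
  alpha * (degree x)%:R * (x == y)%:R + (1 - alpha) * (edge x y)%:R.

Lemma alpha_mxE : alpha_mx G alpha = kernel_mx alpha_ker.
Proof.
apply/matrixP => i j; rewrite !mxE /alpha_ker (inj_eq enum_val_inj).
by rewrite -mulrA mulr_natr.
Qed.

Lemma alpha_ker_sym x y : alpha_ker x y = alpha_ker y x.
Proof.
rewrite /alpha_ker edge_sym eq_sym; congr (_ + _).
by have [->//|] := eqVneq; rewrite !mulr0.
Qed.

Lemma alpha_ker_act f x : \sum_y f y * alpha_ker y x =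
  alpha * (degree x)%:R * f x + (1 - alpha) * \sum_(y | edge x y) f y.
Proof.
rewrite mulr_sumr [in RHS]big_mkcond /= (bigD1 x)//= [in RHS](bigD1 x)//=.
rewrite addrA; congr (_ + _).
  by rewrite /alpha_ker eqxx edge_irr /=; ring.
apply: eq_bigr => y /negPf yx; rewrite /alpha_ker yx edge_sym.
by case: ifP => _ /=; ring.
Qed.

Lemma degreeE (x : G) : (degree x)%:R = \sum_(y | edge x y) 1 :> R.
Proof. by rewrite sumr_const /degree. Qed.

Hypothesis G0 : (0 < #|G|)%N.

Lemma rho_eigenvalue :
  eigenvalue (alpha_mx G alpha) (rho G alpha) /\
  forall z, dot (z *m alpha_mx G alpha) z <= rho G alpha * dot z z.
Proof.
apply: top_eigenvalue => //; rewrite alpha_mxE.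
exact: kernel_mx_sym alpha_ker_sym.
Qed.

Lemma rho_eigenfun : exists f, (exists x, f x != 0) /\
  forall x, \sum_y f y * alpha_ker y x = rho G alpha * f x.
Proof.
have [/eigenvalueP[z zA z0] _] := rho_eigenvalue.
have [f zf] := vecP z; exists f; split.
  by case/rV0Pn: z0; rewrite zf => i; rewrite mxE; exists (enum_val i).
move: zA; rewrite zf alpha_mxE vec_kernel => /rowP zA x.
by have := zA (enum_rank x); rewrite !mxE enum_rankK.
Qed.

Lemma rho_rayleigh f : quad alpha_ker f <= rho G alpha * \sum_x f x ^+ 2.
Proof.
rewrite -dot_kernel -alpha_mxE.
have -> : \sum_x f x ^+ 2 = dot (vec f) (vec f) by rewrite dot_vec.
by have [_] := rho_eigenvalue.
Qed.

Lemma rho_rayleigh_eq f : quad alpha_ker f = rho G alpha * \sum_x f x ^+ 2 ->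
  forall x, \sum_y f y * alpha_ker y x = rho G alpha * f x.
Proof.
have [_ ray] := rho_eigenvalue.
rewrite -dot_kernel -alpha_mxE.
have -> : \sum_x f x ^+ 2 = dot (vec f) (vec f) by rewrite dot_vec.
move=> /(rayleigh_eq _ ray); rewrite alpha_mxE vec_kernel => H.
have /H/rowP {}H := kernel_mx_sym alpha_ker_sym.
by move=> x; have := H (enum_rank x); rewrite !mxE enum_rankK.
Qed.

Hypotheses (alpha_ge0 : 0 <= alpha) (alpha_lt1 : alpha < 1).

Lemma alpha_ker_ge0 x y : 0 <= alpha_ker x y.
Proof. by rewrite addr_ge0// !mulr_ge0// subr_ge0 ltW. Qed.

(** The Rayleigh inequality for the indicator function of [x]. *)
Lemma rho_ge_diag (x : G) : alpha * (degree x)%:R <= rho G alpha.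
Proof.
have := rho_rayleigh (fun y => (y == x)%:R); rewrite quad_act.
rewrite (bigD1 x)//= [X in _ + X]big1 => [|y /negPf yx]; last first.
  by rewrite yx mul0r.
rewrite [X in _ <= _ * X](bigD1 x)//= [X in _ <= _ * (_ + X)]big1; last first.
  by move=> y /negPf yx; rewrite yx expr0n.
rewrite alpha_ker_act eqxx [X in _ + _ * X]big1; first by move=> /=; lra.
by move=> y; case: eqVneq => // ->; rewrite edge_irr.
Qed.

Lemma rho_ge0 : 0 <= rho G alpha.
Proof.
have /card_gt0P[x _] := G0.
by apply: le_trans (rho_ge_diag x); rewrite mulr_ge0.
Qed.

(** The easy half of Perron-Frobenius: if [g] is an eigenfunction for the radius,
    pairing [rho |g| <= A |g|] with the positive eigenfunction [f] gives
    [rho <f, |g|> <= l <f, |g|>]. *)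
Lemma rho_of_pos_eigenfun f l : (forall x, 0 < f x) ->
  (forall x, \sum_y f y * alpha_ker y x = l * f x) -> rho G alpha = l.
Proof.
move=> f0 fl; apply/eqP; rewrite eq_le; apply/andP; split; last first.
  have sf : 0 < \sum_x f x ^+ 2.
    have /card_gt0P[x _] := G0.
    rewrite (bigD1 x)//= ltr_wpDr ?exprn_gt0// sumr_ge0// => y _.
    by rewrite sqr_ge0.
  rewrite -(ler_pM2r sf); apply: le_trans (rho_rayleigh f).
  rewrite quad_act mulr_sumr; apply: ler_sum => x _.
  by rewrite fl expr2 mulrCA.
have [g [[x gx] gr]] := rho_eigenfun.
pose S := \sum_x f x * `|g x|.
have S0 : 0 < S.
  rewrite /S (bigD1 x)//= ltr_wpDr ?mulr_gt0 ?normr_gt0//.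
  by rewrite sumr_ge0// => y _; rewrite mulr_ge0// ltW.
rewrite -(ler_pM2r S0).
have -> : l * S = \sum_x \sum_y f x * `|g y| * alpha_ker y x.
  rewrite exchange_big mulr_sumr; apply: eq_bigr => y _ /=.
  rewrite mulrA -fl mulr_suml; apply: eq_bigr => z _.
  by rewrite alpha_ker_sym mulrAC.
rewrite mulr_sumr; apply: ler_sum => y _.
rewrite mulrCA -{1}(ger0_norm rho_ge0) -normrM -gr.
apply: le_trans (ler_wpM2l (ltW (f0 y)) (ler_norm_sum _ _ _)) _.
rewrite mulr_sumr; apply: ler_sum => z _.
by rewrite normrM (ger0_norm (alpha_ker_ge0 _ _)) mulrA.
Qed.

End AlphaKernel.

(** * Deleting a vertex *)

Section Deletion.
Variables (R : realType) (G : sgraph) (v : G) (alpha : R).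
Hypotheses (alpha_ge0 : 0 <= alpha) (alpha_lt1 : alpha < 1).

Lemma card_del_vertex : #|del_vertex v| = #|G|.-1.
Proof.
rewrite card_sig (eq_card (B := predC1 v)) => [|x]; last by rewrite !inE.
exact: cardC1.
Qed.

Hypothesis G1 : (1 < #|G|)%N.
Implicit Types (f : G -> R).

Local Notation r := (rho G alpha).
Local Notation s := (rho (del_vertex v) alpha + alpha).
Local Notation d := ((degree v)%:R : R).
Local Notation ker := (alpha_ker alpha).

Let G0 : (0 < #|G|)%N := ltnW G1.

Lemma del_vertex_gt0 : (0 < #|del_vertex v|)%N.
Proof.
by rewrite card_del_vertex -subn1 subn_gt0.
Qed.

Lemma sum_del (F : G -> R) :
  \sum_(x | x != v) F x = \sum_(u : del_vertex v) F (val u).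
Proof. exact: (big_sub [pred x | x != v] F). Qed.

Lemma degree_del (u : del_vertex v) :
  (degree (val u))%:R = (degree u)%:R + (edge (val u) v)%:R :> R.
Proof.
rewrite !degreeE [LHS]big_mkcond (bigD1 v)//= addrC; congr (_ + _).
  by rewrite sum_del -big_mkcond.
by case: edge.
Qed.

Lemma alpha_ker_del (u w : del_vertex v) :
  ker (val u) (val w) = ker u w + alpha * (edge (val u) v)%:R * (u == w)%:R.
Proof. by rewrite /alpha_ker degree_del (inj_eq val_inj) /=; ring. Qed.

(** The kernel stays on [G], vanishing at [v], so that it acts on the restriction
    of an eigenfunction of [G] without a change of index type. *)
Definition del_ker (x y : G) : R :=
  if (x == v) || (y == v) then 0 else ker x y.

Lemma del_ker_sym x y : del_ker x y = del_ker y x.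
Proof. by rewrite /del_ker orbC alpha_ker_sym. Qed.

Lemma del_ker_ge0 x y : 0 <= del_ker x y.
Proof. by rewrite /del_ker; case: ifP => // _; exact: alpha_ker_ge0. Qed.

(** On functions vanishing at [v], the form of [G] is that of [G - v] plus
    [alpha] times the sum of the squares over the neighbours of [v]. *)
Lemma del_quad_le f : quad del_ker f <= s * \sum_x f x ^+ 2.
Proof.
pose g (u : del_vertex v) := f (val u).
have -> : quad del_ker f = quad ker g +
    alpha * \sum_(u : del_vertex v) (edge (val u) v)%:R * g u ^+ 2.
  rewrite /quad (bigD1 v)//= [X in X + _]big1 => [|y _]; last first.
    by rewrite /del_ker eqxx mulr0 mul0r.
  rewrite add0r sum_del mulr_sumr -big_split; apply: eq_bigr => u _ /=.
  rewrite (bigD1 v)//= {1}/del_ker eqxx orbT mulr0 mul0r add0r sum_del.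
  rewrite (bigD1 u)//= [in RHS](bigD1 u)//= addrAC; congr (_ + _).
    by rewrite /del_ker (negPf (valP u)) alpha_ker_del eqxx /g /=; ring.
  apply: eq_bigr => w wu; rewrite /del_ker (negPf (valP u)) (negPf (valP w)).
  by rewrite alpha_ker_del [u == w]eq_sym (negPf wu) /g /=; ring.
have rd0 := rho_ge0 del_vertex_gt0 alpha_ge0.
have sum_le : \sum_u g u ^+ 2 <= \sum_x f x ^+ 2.
  by rewrite (bigD1 v (F := fun x => f x ^+ 2))//= sum_del lerDr sqr_ge0.
apply: (@le_trans _ _ (s * \sum_u g u ^+ 2)); last first.
  by rewrite ler_wpM2l// addr_ge0.
rewrite mulrDl lerD//; first exact: (rho_rayleigh alpha del_vertex_gt0 g).
rewrite ler_wpM2l//; apply: ler_sum => u _.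
by rewrite -[leRHS]mul1r ler_wpM2r ?sqr_ge0//; case: edge.
Qed.

Lemma del_radius_ge0 : 0 <= s.
Proof. exact: addr_ge0 (rho_ge0 del_vertex_gt0 alpha_ge0) alpha_ge0. Qed.

(** The kernel is nonnegative, so [|<zM, z>|] is at most the form at [|z|]. *)
Lemma del_quad_abs_le (z : 'rV[R]_#|G|) :
  `|dot (z *m kernel_mx del_ker) z| <= s * dot z z.
Proof.
have [f ->] := vecP z; rewrite dot_kernel dot_vec.
apply: le_trans (quad_abs _ del_ker_ge0) _.
apply: le_trans (del_quad_le _) _; rewrite ler_wpM2l ?del_radius_ge0//.
by apply: ler_sum => x _; rewrite real_normK ?num_real.
Qed.

Definition nbr (x : G) : R := (edge v x)%:R.

Lemma sum_nbr f : \sum_x nbr x * f x = \sum_(x | edge v x) f x.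
Proof.
rewrite [RHS]big_mkcond; apply: eq_bigr => x _.
by rewrite /nbr; case: edge; rewrite ?mul1r ?mul0r.
Qed.

Lemma del_quad_nbr : quad del_ker nbr = quad ker nbr.
Proof.
apply: eq_bigr => x _; apply: eq_bigr => y _; rewrite /del_ker.
have [->|_] := eqVneq x v; first by rewrite /nbr edge_irr !mul0r.
by have [->|_] := eqVneq y v; first by rewrite /nbr edge_irr !mulr0.
Qed.

(** For an eigenfunction [f] of [G] and its restriction [y] off [v], the eigenvalue
    equation off [v] is [r y - y M = (1 - alpha) (f v) b], and at [v] it is
    [(1 - alpha) <b, y> = (r - alpha d) (f v)]; [f v] is nonzero because [r > s]
    exceeds the spectrum of [M]. So [resolvent_bound] applies. In its equality
    case [b M^2 = s^2 b], and at a vertex where [b] vanishes all the nonnegative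
    terms of [b M^2] vanish. *)
Lemma deletion_bound : alpha * d < r ->
  (r - alpha * d) * (r ^+ 2 - s ^+ 2) <=
    (1 - alpha) ^+ 2 * (r * d + quad ker nbr) /\
  ((0 < degree v)%N ->
   (r - alpha * d) * (r ^+ 2 - s ^+ 2) =
     (1 - alpha) ^+ 2 * (r * d + quad ker nbr) ->
   forall w t u, edge v w -> t != v -> u != v -> ~~ edge v u ->
     ker w t * ker t u = 0).
Proof.
move=> rd; have s0 := del_radius_ge0.
have r0 : 0 < r by apply: le_lt_trans rd; rewrite mulr_ge0.
have B0 : 0 <= quad ker nbr.
  apply: sumr_ge0 => x _; apply: sumr_ge0 => y _.
  by rewrite !mulr_ge0//; exact: alpha_ker_ge0.
have a10 : 0 < 1 - alpha by rewrite subr_gt0.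
have [rs|sr] := lerP r s.
  have lhs0 : (r - alpha * d) * (r ^+ 2 - s ^+ 2) <= 0.
    by rewrite pmulr_rle0 ?subr_gt0// subr_le0 ler_sqr ?nnegrE// ltW.
  split.
    apply: le_trans lhs0 _; rewrite mulr_ge0 ?sqr_ge0// addr_ge0//.
    by rewrite mulr_ge0// ltW.
  move=> d0 eqB; exfalso; move: lhs0; rewrite eqB; apply/negP; rewrite -ltNge.
  by rewrite mulr_gt0 ?exprn_gt0// ltr_wpDr// mulr_gt0// ltr0n.
have [f [[x0 fx0] fr]] := rho_eigenfun alpha G0.
pose g x := if x == v then 0 else f x.
pose M := kernel_mx del_ker.
pose c := (1 - alpha) * f v.
pose y := vec g.
have symM : M^T = M := kernel_mx_sym del_ker_sym.
have yM : r *: y - y *m M = c *: vec nbr.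
  rewrite /y vec_kernel; apply/rowP => i; rewrite !mxE.
  set x := enum_val i; rewrite /g.
  have [->|xv] := eqVneq x v.
    rewrite big1 => [|z _]; first by rewrite /nbr edge_irr /=; ring.
    by rewrite /del_ker eqxx orbT mulr0.
  rewrite -fr (bigD1 v)//= [X in _ - X](bigD1 v)//= eqxx mul0r add0r.
  rewrite [X in _ + X - _](eq_bigr (fun z => (if z == v then 0 else f z) * del_ker z x)).
    by rewrite addrK /c /nbr /alpha_ker eq_sym (negPf xv) /=; ring.
  by move=> z /negPf zv; rewrite zv /del_ker zv (negPf xv).
have fv : f v != 0.
  apply: contra_neq fx0 => fv0.
  have : y = 0.
    apply: dot_eq0; apply/eqP; rewrite eq_le dot_ge0 andbT.
    have := del_quad_abs_le y; rewrite -/M.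
    have -> : y *m M = r *: y.
      by apply/esym/eqP; rewrite -subr_eq0 yM /c fv0 mulr0 scale0r.
    rewrite dotZl => /(le_trans (ler_norm _)).
    by rewrite -subr_ge0 -mulrBl nmulr_rge0// subr_lt0.
  move=> /rowP/(_ (enum_rank x0)); rewrite !mxE enum_rankK /g.
  by case: eqVneq => [->|//].
have c0 : c != 0 by rewrite mulf_neq0// gt_eqF.
have bby : (1 - alpha) * dot (vec nbr) y = (r - alpha * d) * f v.
  rewrite dot_vec sum_nbr [RHS]mulrBl -fr alpha_ker_act [RHS]addrC addKr.
  congr (_ * _); apply: eq_bigr => z; rewrite /g.
  by case: eqVneq => // ->; rewrite edge_irr.
have bb : dot (vec nbr) (vec nbr) = d.
  rewrite dot_vec sum_nbr degreeE; apply: eq_bigr => z vz.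
  by rewrite /nbr vz.
have [] := resolvent_bound y symM s0 sr del_quad_abs_le.
rewrite yM -scalemxAl !dotE bb dot_kernel del_quad_nbr -scalemxAl => le_b eq_b.
have scl X : f v ^+ 2 * ((r - alpha * d) * X) = X * (c * dot (vec nbr) y).
  have -> : X * (c * dot (vec nbr) y) = X * f v * ((1 - alpha) * dot (vec nbr) y).
    by rewrite /c; ring.
  by rewrite bby; ring.
(* every term below carries the factor [f v ^+ 2] *)
have fv2 : 0 < f v ^+ 2 by rewrite exprn_even_gt0.
have sclr : f v ^+ 2 * ((1 - alpha) ^+ 2 * (r * d + quad ker nbr)) =
  r * (c * (c * d)) + c * (c * quad ker nbr) by rewrite /c; ring.
split; first by rewrite -(ler_pM2l fv2) scl sclr.
move=> d0 eqB w t u vw tv uv vu.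
have {}eq_b : s ^+ 2 *: (c *: vec nbr) = c *: (vec nbr *m M *m M).
  by rewrite -eq_b// -?scalemxAl// -scl -sclr eqB.
have bMM : vec nbr *m M *m M = s ^+ 2 *: vec nbr.
  by apply: (scalerI c0); rewrite -eq_b !scalerA mulrC.
have : \sum_q (\sum_p nbr p * del_ker p q) * del_ker q u = 0.
  move: bMM; rewrite !vec_kernel => /rowP/(_ (enum_rank u)).
  by rewrite !mxE enum_rankK {2}/nbr (negPf vu) mulr0.
have nd0 q : 0 <= \sum_p nbr p * del_ker p q.
  by apply: sumr_ge0 => p _; rewrite mulr_ge0 ?del_ker_ge0.
move=> /eqP; rewrite psumr_eq0 => [/allP/(_ t (mem_index_enum t))|q _]; last first.
  by rewrite mulr_ge0 ?del_ker_ge0.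
rewrite /= mulf_eq0 => /orP[]; last first.
  by rewrite /del_ker (negPf tv) (negPf uv) => /eqP ->; rewrite mulr0.
rewrite psumr_eq0 => [/allP/(_ w (mem_index_enum w))|p _]; last first.
  by rewrite mulr_ge0 ?del_ker_ge0.
have wv : w != v by apply: contraTneq vw => ->; rewrite edge_irr.
rewrite /= /nbr vw mul1r /del_ker (negPf tv) (negPf wv) => /eqP ->.
by rewrite mul0r.
Qed.

End Deletion.

(** * Complete graphs and stars *)

Section Graphs.
Variable G : sgraph.
Implicit Types x y v w c : G.

Lemma degree_lt x : (degree x < #|G|)%N.
Proof.
have /card_gt0P G0 : exists y : G, y \in G by exists x.
rewrite -(prednK G0) ltnS -(cardC1 x); apply/subset_leq_card/fintype.subsetP => y.
by rewrite !inE; apply: contraTneq => ->; rewrite edge_irr.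
Qed.

Lemma degree_complete x : (forall y, x != y -> edge x y) ->
  degree x = #|G|.-1.
Proof.
move=> xy; rewrite -(cardC1 x); apply: eq_card => y; rewrite !inE.
rewrite eq_sym; apply/idP/idP; last exact: xy.
by apply: contraTneq => ->; rewrite edge_irr.
Qed.

Lemma universal_of_degree x : degree x = #|G|.-1 -> forall y, x != y -> edge x y.
Proof.
move=> dx y xy; apply: contraT => nxy.
have : ([pred u | edge x u] \proper predC1 x).
  apply/fintype.properP; split.
    apply/fintype.subsetP => z; rewrite !inE.
    by apply: contraTneq => ->; rewrite edge_irr.
  by exists y; rewrite !inE 1?eq_sym.
by move=> /proper_card; rewrite cardC1 -dx ltnn.
Qed.

Lemma connected_closed (A : pred G) x : connected G -> A x ->
  (forall y z, A y -> edge y z -> A z) -> forall y, A y.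
Proof.
move=> conn Ax clA y; have /connectP[p ep ->] := conn x y.
elim: p x Ax ep {conn} => //= z p IH x Ax /andP[xz]; apply: IH.
exact: clA Ax xz.
Qed.

Lemma degree_gt0 x : connected G -> (1 < #|G|)%N -> (0 < degree x)%N.
Proof.
move=> conn G1; rewrite lt0n; apply/negP => /eqP/card0_eq nx.
have ally : forall y, y == x.
  apply: (connected_closed (A := pred1 x) conn (eqxx x)) => y z /eqP -> xz.
  by have := nx z; rewrite !inE xz.
have := G1; rewrite (eq_card (B := pred1 x)) ?card1// => y.
by rewrite !inE ally.
Qed.

Lemma complete_graphE n (i j : complete_graph n) : edge i j = (i != j).
Proof. by []. Qed.

Lemma iso_complete n : #|G| = n -> (forall x y, x != y -> edge x y) ->
  isomorphic G (complete_graph n).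
Proof.
move=> Gn compl; exists (fun x => cast_ord Gn (enum_rank x)).
  exists (fun i => enum_val (cast_ord (esym Gn) i)) => x.
    by rewrite cast_ordK enum_rankK.
  by rewrite enum_valK cast_ordKV.
move=> x y; rewrite complete_graphE (inj_eq (@cast_ord_inj _ _ _)).
rewrite (inj_eq enum_rank_inj); apply/idP/idP; first exact: compl.
by apply: contraTneq => ->; rewrite edge_irr.
Qed.

Lemma complete_iso n : isomorphic G (complete_graph n) ->
  forall x y, x != y -> edge x y.
Proof.
move=> [f fbij fE] x y xy; rewrite -fE complete_graphE.
by rewrite (inj_eq (bij_inj fbij)).
Qed.

(** As an equation for the edge relation, this form is invariant under
    isomorphism and passes to [G - v] for [v] other than the centre. *)
Definition is_star c := forall x y, edge x y = (x == c) (+) (y == c).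

Lemma bipartite1_star m (a b : complete_bipartite_graph 1 m) :
  edge a b = (a == inl ord0) (+) (b == inl ord0).
Proof.
by case: a b => [i|i] [j|j] //=; rewrite ?(ord1 i) ?(ord1 j) ?eqxx.
Qed.

(** Any bijection onto the bipartite graph becomes an isomorphism once a
    transposition has moved the image of [c] to the single left vertex. *)
Lemma iso_star n c : #|G| = n -> is_star c ->
  isomorphic G (complete_bipartite_graph 1 n.-1).
Proof.
move=> Gn star.
have n0 : (0 < n)%N by rewrite -Gn; apply/card_gt0P; exists c.
have Gcard : #|G| = #|{: 'I_1 + 'I_n.-1}|.
  by rewrite card_sum !card_ord add1n prednK.
pose g (x : G) : 'I_1 + 'I_n.-1 := enum_val (cast_ord Gcard (enum_rank x)).
have gbij : bijective g.
  exists (fun a => enum_val (cast_ord (esym Gcard) (enum_rank a))) => x.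
    by rewrite /g enum_valK cast_ordK enum_rankK.
  by rewrite /g enum_valK cast_ordKV enum_rankK.
pose f x := tperm (g c) (inl ord0) (g x).
have fbij : bijective f by apply: bij_comp gbij; apply: injF_bij; apply: perm_inj.
exists f => // x y; rewrite bipartite1_star star.
have fc : inl ord0 = f c by rewrite /f tpermL.
by rewrite fc !(inj_eq (bij_inj fbij)).
Qed.

Lemma star_iso m : isomorphic G (complete_bipartite_graph 1 m) ->
  exists c, is_star c.
Proof.
move=> [f fbij fE]; have [h fK hK] := fbij.
exists (h (inl ord0)) => x y; rewrite -fE bipartite1_star.
by rewrite -!(inj_eq (bij_inj fbij)) hK.
Qed.

End Graphs.

Section Radii.
Variables (R : realType).

Lemma rho_regular (G : sgraph) (alpha : R) m : 0 <= alpha -> alpha < 1 ->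
  (0 < #|G|)%N -> (forall x : G, degree x = m) -> rho G alpha = m%:R.
Proof.
move=> a0 a1 G0 reg; apply: (rho_of_pos_eigenfun G0 a0 a1 (f := fun=> 1)).
  by move=> x; exact: ltr01.
by move=> x; rewrite alpha_ker_act -degreeE reg; ring.
Qed.

Lemma rho_complete (G : sgraph) (alpha : R) : 0 <= alpha -> alpha < 1 ->
  (0 < #|G|)%N -> (forall x y : G, x != y -> edge x y) ->
  rho G alpha = #|G|%:R - 1.
Proof.
move=> a0 a1 G0 compl; rewrite (rho_regular a0 a1 G0 (m := #|G|.-1)).
  by rewrite -subn1 natrB.
by move=> x; apply: degree_complete => y; exact: compl.
Qed.

(** The eigenfunction takes the value [sqrt (n - 1)] at the centre and 1 at the
    leaves. It vanishes at the centre when [n = 1], a case settled by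
    regularity. *)
Lemma rho_star (G : sgraph) (c : G) : is_star c ->
  rho G 0 = Num.sqrt (#|G|%:R - 1 : R).
Proof.
move=> star; have G0 : (0 < #|G|)%N by apply/card_gt0P; exists c.
have deg_c : degree c = #|G|.-1.
  by apply: degree_complete => y cy; rewrite star eqxx eq_sym (negPf cy).
have [G1|G1] := leqP #|G| 1.
  have G_1 : #|G| = 1%N by apply/eqP; rewrite eqn_leq G1.
  rewrite G_1 subrr sqrtr0 (rho_regular _ _ _ (m := 0))// => x.
  by have := degree_lt x; rewrite G_1 ltnS leqn0 => /eqP.
have n1 : 0 < #|G|%:R - 1 :> R by rewrite subr_gt0 ltr1n.
apply: (rho_of_pos_eigenfun G0 _ _
  (f := fun x => if x == c then Num.sqrt (#|G|%:R - 1) else 1)) => //.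
  by move=> x; case: ifP => // _; rewrite sqrtr_gt0.
move=> x; rewrite alpha_ker_act mul0r mul0r add0r subr0 mul1r.
have [->|xc] := eqVneq x c.
  rewrite -expr2 sqr_sqrtr ?ltW// (eq_bigr (fun=> 1)) => [|y].
    by rewrite -degreeE deg_c -subn1 natrB.
  by rewrite star eqxx /=; case: eqVneq.
rewrite (eq_bigl (pred1 c)) => [|y]; last by rewrite star (negPf xc).
by rewrite big_pred1_eq eqxx mulr1.
Qed.

End Radii.

(** * The form at the neighbourhood of a vertex *)

Section Neighbourhood.
Variables (R : realType) (G : sgraph) (v : G) (alpha : R).
Hypotheses (alpha_ge0 : 0 <= alpha) (alpha_lt1 : alpha < 1).

Local Notation r := (rho G alpha).
Local Notation d := ((degree v)%:R : R).
Local Notation n := (#|G|%:R : R).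
Local Notation ker := (alpha_ker alpha).
Local Notation b := (nbr R v).

Let G0 : (0 < #|G|)%N. Proof. by apply/card_gt0P; exists v. Qed.

Lemma degree_le (x : G) : (degree x)%:R <= n - 1.
Proof. by rewrite lerBrDr natr1 ler_nat degree_lt. Qed.

Lemma common_nbr_defect x : edge v x ->
  \sum_(y | edge x y) b y =
  d - 1 - \sum_(y | edge v y && (y != x)) (~~ edge x y)%:R.
Proof.
move=> vx; rewrite degreeE [X in X - 1 - _](bigD1 x)//= [1 + _]addrC addrK.
rewrite -sumrB [LHS]big_mkcond [RHS]big_mkcond; apply: eq_bigr => y _ /=.
rewrite /nbr; have [->|yx] := eqVneq y x; first by rewrite edge_irr andbF.
by case: (edge x y); case: (edge v y); rewrite /= ?subr0 ?subrr.
Qed.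

(** The gap is [alpha] times the sum over [x] in [N] of [n - 1 - degree x], plus
    [1 - alpha] times the number of ordered pairs of distinct nonadjacent
    vertices of [N]. *)
Lemma quad_nbr_le :
  quad ker b <= alpha * d * (n - 1) + (1 - alpha) * d * (d - 1) /\
  (quad ker b = alpha * d * (n - 1) + (1 - alpha) * d * (d - 1) ->
   forall x y, edge v x -> edge v y -> x != y -> edge x y).
Proof.
have a10 : 0 < 1 - alpha by rewrite subr_gt0.
pose D x : R := \sum_(y | edge v y && (y != x)) (~~ edge x y)%:R.
have D0 x : 0 <= D x by apply: sumr_ge0.
have gap : alpha * d * (n - 1) + (1 - alpha) * d * (d - 1) - quad ker b =
    \sum_(x | edge v x) (alpha * (n - 1 - (degree x)%:R) + (1 - alpha) * D x).
  rewrite quad_act sum_nbr.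
  have -> : alpha * d * (n - 1) + (1 - alpha) * d * (d - 1) =
    \sum_(x | edge v x) (alpha * (n - 1) + (1 - alpha) * (d - 1)).
    by rewrite -[in RHS](mul1r (_ + _)) -mulr_suml -degreeE; ring.
  rewrite -sumrB; apply: eq_bigr => x vx.
  by rewrite alpha_ker_act common_nbr_defect// /nbr vx /D /=; ring.
have term0 x : 0 <= alpha * (n - 1 - (degree x)%:R) + (1 - alpha) * D x.
  by rewrite addr_ge0// mulr_ge0// ?subr_ge0 ?degree_le// ltW.
split; first by rewrite -subr_ge0 gap sumr_ge0.
move=> /esym/eqP; rewrite -subr_eq0 gap psumr_eq0// => /allP eq0 x y vx vy xy.
have := eq0 x (mem_index_enum x); rewrite vx paddr_eq0; last 2 first.
- by rewrite mulr_ge0// subr_ge0 degree_le.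
- by rewrite mulr_ge0// ltW.
move=> /andP[_]; rewrite mulf_eq0 (gt_eqF a10) /=.
rewrite psumr_eq0 => [/allP/(_ y (mem_index_enum y))|//].
by rewrite vy eq_sym xy /= pnatr_eq0 eqb0 negbK.
Qed.

(** The Rayleigh inequality for the indicator function of the closed
    neighbourhood, whose square norm is [d + 1] and whose form is
    [alpha d + 2 (1 - alpha) d] plus the form at [b]. *)
Lemma rayleigh_closed_nbr :
  r * d + quad ker b <= (2 * d + 1) * r - 2 * d + alpha * d /\
  (r * d + quad ker b = (2 * d + 1) * r - 2 * d + alpha * d ->
   forall x, \sum_y ((y == v)%:R + b y) * ker y x = r * ((x == v)%:R + b x)).
Proof.
pose f x : R := (x == v)%:R + b x.
have delta (F : G -> R) : \sum_y (y == v)%:R * F y = F v.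
  rewrite (bigD1 v)//= eqxx mul1r big1 ?addr0// => y /negPf ->.
  by rewrite mul0r.
have sumker : \sum_y b y * ker y v = (1 - alpha) * d.
  rewrite sum_nbr degreeE mulr_sumr; apply: eq_bigr => y vy.
  rewrite /alpha_ker edge_sym vy; case: eqVneq vy => [->|]; first by rewrite edge_irr.
  by move=> _ _; rewrite /=; ring.
have sumf : \sum_x f x ^+ 2 = d + 1.
  have -> : d + 1 = \sum_x (b x * 1 + (x == v)%:R * 1).
    by rewrite big_split /= sum_nbr delta -degreeE.
  apply: eq_bigr => x _.
  rewrite /f /nbr /=; case: eqVneq => [->|_]; first by rewrite edge_irr /=; ring.
  by case: edge => /=; ring.
have quadf : quad ker f = alpha * d + 2 * (1 - alpha) * d + quad ker b.
  have act x : \sum_y f y * ker y x = ker v x + \sum_y b y * ker y x.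
    rewrite -(delta (fun y => ker y x)) -big_split; apply: eq_bigr => y _.
    by rewrite /f mulrDl.
  rewrite !quad_act (eq_bigr (fun x => (x == v)%:R * (\sum_y f y * ker y x) +
     b x * ker x v + b x * (\sum_y b y * ker y x))) => [|x _]; last first.
    by rewrite {1}/f mulrDl act (alpha_ker_sym alpha x v); ring.
  rewrite !big_split /= delta act sumker.
  by rewrite /alpha_ker eqxx edge_irr /=; ring.
have ray := rho_rayleigh alpha G0 f; rewrite quadf sumf in ray.
split; first by lra.
move=> eqr; apply: (rho_rayleigh_eq G0); rewrite -/f quadf sumf; lra.
Qed.

End Neighbourhood.

(** * The bound and its equality cases *)

Section Bound.
Variables (R : realType) (G : sgraph) (v : G) (alpha : R).
Hypotheses (alpha_ge0 : 0 <= alpha) (alpha_lt1 : alpha < 1).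

Local Notation r := (rho G alpha).
Local Notation s := (rho (del_vertex v) alpha + alpha).
Local Notation d := ((degree v)%:R : R).
Local Notation n := (#|G|%:R : R).
Local Notation ker := (alpha_ker alpha).
Local Notation b := (nbr R v).

Let G0 : (0 < #|G|)%N. Proof. by apply/card_gt0P; exists v. Qed.

Lemma card_gt1_of_rho : r != alpha * d -> (1 < #|G|)%N.
Proof.
apply: contraNT; rewrite -leqNgt => /card_le1_eqP G1.
have allv (x : G) : x = v by apply: G1.
have [f [[x fx] fr]] := rho_eigenfun alpha G0.
rewrite (allv x) in fx; have := fr v.
rewrite alpha_ker_act [X in _ + _ * X]big1 => [|y]; last first.
  by rewrite (allv y) edge_irr.
by rewrite mulr0 addr0 => /(mulIf fx) ->.
Qed.

(** The second factor of the bound in the theorem, multiplied by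
    [r - alpha d]. *)
Definition bound_numerator (k : R) : R :=
  (2 * d - 1) * (r - alpha * d) + alpha * d * (n + d - 1) + (k - 2) * (d - r).

Lemma bound_numerator_interpolation k : (d + 1) * bound_numerator k =
  (d + 1 - k) * bound_numerator 0 + k * bound_numerator (d + 1).
Proof. by rewrite /bound_numerator; ring. Qed.

(** The numerator at 0 exceeds the bound of [rayleigh_closed_nbr] by
    [alpha d (n - 1 - d)]. *)
Lemma rayleigh_le_numerator :
  r * d + quad ker b <= bound_numerator 0 /\
  (r * d + quad ker b = bound_numerator 0 ->
   forall x, \sum_y ((y == v)%:R + b y) * ker y x = r * ((x == v)%:R + b x)).
Proof.
have [le1 eq1] := rayleigh_closed_nbr v alpha.
have dn : 0 <= alpha * d * (n - 1 - d).
  by rewrite !mulr_ge0// subr_ge0 degree_le.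
have E : bound_numerator 0 = (2 * d + 1) * r - 2 * d + alpha * d + alpha * d * (n - 1 - d).
  by rewrite /bound_numerator; ring.
split; first by lra.
by move=> eq0; apply: eq1; lra.
Qed.

Lemma counting_le_numerator :
  r * d + quad ker b <= bound_numerator (d + 1) /\
  (r * d + quad ker b = bound_numerator (d + 1) ->
   forall x y, edge v x -> edge v y -> x != y -> edge x y).
Proof.
have [le1 eq1] := quad_nbr_le v alpha_ge0 alpha_lt1.
have E : bound_numerator (d + 1) =
    r * d + (alpha * d * (n - 1) + (1 - alpha) * d * (d - 1)).
  by rewrite /bound_numerator; ring.
split; first by rewrite E lerD2l.
by rewrite E => /addrI/eq1.
Qed.

(** Both ends of the range of [k] bound the left-hand side, and for [k < d + 1]
    the end [k = 0] has positive weight in the interpolation. *)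
Lemma le_numerator k : 0 <= k -> k <= d + 1 ->
  r * d + quad ker b <= bound_numerator k /\
  (r * d + quad ker b = bound_numerator k -> k != d + 1 ->
   r * d + quad ker b = bound_numerator 0).
Proof.
move=> k0 k1; have d1 : 0 < d + 1 by rewrite ltr_wpDl.
have [le0 _] := rayleigh_le_numerator; have [le1 _] := counting_le_numerator.
have I := bound_numerator_interpolation k.
split; first by rewrite -(ler_pM2l d1) I; nra.
move=> eqk kd.
have {kd} kd : 0 < d + 1 - k by rewrite subr_gt0 lt_neqAle kd.
apply/eqP; rewrite eq_le le0 -(ler_pM2l kd) /=; move: I; rewrite -eqk; nra.
Qed.

(** The zeros of a nonnegative eigenfunction are closed under adjacency, so the
    0-1 function of the hypothesis is constantly 1; the eigenvalue equation then
    says that every degree is [r], and [v] has degree [n - 1]. *)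
Lemma complete_of_eigenfun : connected G ->
  (forall x, \sum_y ((y == v)%:R + b y) * ker y x = r * ((x == v)%:R + b x)) ->
  forall x y : G, x != y -> edge x y.
Proof.
move=> conn eig.
have a10 : 0 < 1 - alpha by rewrite subr_gt0.
pose f x : R := (x == v)%:R + b x.
have f0 x : 0 <= f x by rewrite addr_ge0.
have fpos x : f x != 0.
  apply: (connected_closed (A := fun x => f x != 0) conn (x := v)).
    by rewrite /f eqxx /nbr edge_irr /= addr0 oner_eq0.
  move=> y z fy yz; apply: contra_neqT fy; rewrite negbK => /eqP fz.
  have /eqP := eig z; rewrite -/(f z) fz mulr0.
  rewrite psumr_eq0 => [/allP/(_ y (mem_index_enum y))|w _]; last first.
    exact: mulr_ge0 (f0 w) (alpha_ker_ge0 alpha_ge0 alpha_lt1 w z).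
  rewrite /= mulf_eq0 => /orP[/eqP//|].
  have zy : y == z = false by apply: contraTF yz => /eqP ->; rewrite edge_irr.
  by rewrite /alpha_ker yz zy mulr0 add0r mulr1 gt_eqF.
have f1 x : f x = 1.
  move: (fpos x); rewrite /f /nbr; have [->|_] := eqVneq x v.
    by rewrite edge_irr addr0.
  by case: edge; rewrite add0r// eqxx.
have rdeg (x : G) : r = (degree x)%:R.
  have := eig x; rewrite -/(f x) f1 mulr1 => <-.
  rewrite (eq_bigr (fun y => 1 * ker y x)) => [|y _]; last first.
    by rewrite -/(f y) f1.
  by rewrite (alpha_ker_act alpha (fun=> 1)) -degreeE; ring.
have dv : degree v = #|G|.-1.
  apply: degree_complete => y vy; move: (fpos y).
  by rewrite /f /nbr [y == v]eq_sym (negPf vy) add0r; case: edge; rewrite ?eqxx.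
move=> x; apply: universal_of_degree; rewrite -dv.
by apply/eqP; rewrite -(eqr_nat R) -!rdeg.
Qed.

(** If [v] is not adjacent to all other vertices, some [u] outside the closed
    neighbourhood is adjacent to some [w] in [N]. The two-step walk [w u u]
    forces [alpha = 0], and a second neighbour [x] of [v] would give the walk
    [x w u]. So [w] is the only neighbour of [v]; without two-step walks from [w]
    to the other vertices, these are all adjacent to [w] by connectedness, and
    pairwise nonadjacent. *)
Lemma complete_or_star : connected G ->
  (forall x y, edge v x -> edge v y -> x != y -> edge x y) ->
  (forall w t u, edge v w -> t != v -> u != v -> ~~ edge v u ->
     ker w t * ker t u = 0) ->
  (forall x y : G, x != y -> edge x y) \/
  [/\ exists c : G, is_star c, alpha = 0 & degree v = 1%N].
Proof.
move=> conn clique walk.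
have a10 : 1 - alpha != 0 by rewrite subr_eq0 gt_eqF.
have [univ|] := boolP [forall x, (v != x) ==> edge v x].
  left=> x y xy; have {}univ z : v != z -> edge v z.
    by move=> vz; have /forallP/(_ z)/implyP := univ; apply.
  have [xv|xv] := eqVneq v x; first by rewrite -xv univ// xv.
  have [yv|yv] := eqVneq v y; first by rewrite edge_sym -yv univ.
  by apply: clique => //; apply: univ.
move=> nuniv; right.
have /existsP[w /existsP[u /and4P[vw uv vu wu]]] : [exists w, exists u,
    [&& edge v w, u != v, ~~ edge v u & edge w u]].
  apply: contraNT nuniv => nex; apply/forallP => x; apply/implyP => vx.
  suff : (x == v) || edge v x by rewrite eq_sym (negPf vx).
  apply: (connected_closed (A := fun x => (x == v) || edge v x) conn (x := v)).
    by rewrite eqxx.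
  move=> y z /orP[/eqP->->|vy yz]; first by rewrite orbT.
  apply: contraNT nex; rewrite negb_or => /andP[zv vz].
  by apply/existsP; exists y; apply/existsP; exists z; apply/and4P.
have edge_neq (x y : G) : edge x y -> (x == y) = false.
  by move=> xy; apply: contraTF xy => /eqP ->; rewrite edge_irr.
have kerE (x y : G) : edge x y -> ker x y = 1 - alpha.
  by move=> xy; rewrite /alpha_ker xy edge_neq// mulr0 add0r mulr1.
have alpha0 : alpha = 0.
  have du : (degree u)%:R != 0 :> R.
    rewrite pnatr_eq0 -lt0n; apply/card_gt0P; exists w.
    by rewrite inE edge_sym.
  have /eqP := walk w u u vw uv uv vu.
  rewrite kerE// mulf_eq0 (negPf a10) /alpha_ker eqxx edge_irr /=.
  by rewrite mulr0 addr0 mulr1 mulf_eq0 (negPf du) orbF => /eqP.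
have ker0 (x y : G) : ker x y = (edge x y)%:R.
  by rewrite /alpha_ker alpha0 !mul0r add0r subr0 mul1r.
have nowalk t z x : edge v z -> t != v -> x != v -> ~~ edge v x ->
    edge z t -> ~~ edge t x.
  move=> vz tv xv vx zt; have /eqP := walk z t x vz tv xv vx.
  by rewrite !ker0 zt mul1r pnatr_eq0 eqb0.
have onlyw x : edge v x -> x = w.
  move=> vx; apply/eqP; apply: contraT => xw.
  have wv : w != v by rewrite eq_sym edge_neq.
  by have := nowalk w x u vx wv uv vu (clique x w vx vw xw); rewrite wu.
have nbr_v x : edge v x = (x == w) by apply/idP/eqP => [/onlyw//|->].
split=> //; last first.
  by rewrite /degree (eq_card (B := pred1 w)) ?card1//.
exists w.
have allw x : (x == w) || edge w x.
  apply: (connected_closed (A := fun x => (x == w) || edge w x) conn (x := w)).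
    by rewrite eqxx.
  move=> y z /orP[/eqP->->|wy yz]; first by rewrite orbT.
  have [zv|zv] := eqVneq z v; first by rewrite zv edge_sym vw orbT.
  have [yv|yv] := eqVneq y v; first by rewrite -nbr_v -yv yz.
  have [//|zw] := eqVneq z w; apply: contraTT yz => _.
  by apply: (nowalk y w) => //; rewrite nbr_v.
move=> x y; have [->|xw] := eqVneq x w.
  have [->|yw] := eqVneq y w; first by rewrite edge_irr.
  by have := allw y; rewrite (negPf yw).
have wx : edge w x by have := allw x; rewrite (negPf xw).
have [->|yw] := eqVneq y w; first by rewrite edge_sym wx.
have [->|xv] := eqVneq x v; first by rewrite nbr_v (negPf yw).
have [->|yv] := eqVneq y v; first by rewrite edge_sym nbr_v (negPf xw).
by apply/negbTE; apply: (nowalk x w) => //; rewrite nbr_v.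
Qed.

End Bound.

Unset Implicit Arguments.

Theorem theorem1p2 (R : realType) (G : sgraph) (n : nat) (v : G) (alpha k : R)
    (order_G : #|G| = n)
    (alpha_ge0 : 0 <= alpha) (alpha_lt1 : alpha < 1)
    (k_ge0 : 0 <= k) (k_le : k <= (degree v)%:R + 1)
    (denominator_neq0 : rho G alpha - alpha * (degree v)%:R != 0) :
  let d : R := (degree v)%:R in
  let r := rho G alpha in
  let r' := rho (del_vertex v) alpha in
  let lhs := r ^+ 2 - (r' + alpha) ^+ 2 in
  let rhs := (1 - alpha) ^+ 2 *
    (2 * d - 1 + (alpha * d * (n%:R + d - 1) + (k - 2) * (d - r)) /
                 (r - alpha * d)) in
  lhs <= rhs /\
  (connected G ->
    (lhs = rhs <->
     isomorphic G (complete_graph n) \/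
     [/\ isomorphic G (complete_bipartite_graph 1 n.-1),
         alpha = 0, degree v = 1%N & k = 2])).
Proof.
have rd : rho G alpha != alpha * (degree v)%:R by rewrite -subr_eq0.
have G1 := card_gt1_of_rho rd; have G0 := ltnW G1.
have rdpos : 0 < rho G alpha - alpha * (degree v)%:R.
  by rewrite subr_gt0 lt_neqAle eq_sym rd rho_ge_diag.
have a10 : 1 - alpha != 0 by rewrite subr_eq0 gt_eqF.
have a2 : 0 < (1 - alpha) ^+ 2 by rewrite exprn_even_gt0.
subst n => d r r' lhs rhs.
have rhsE : (r - alpha * d) * rhs = (1 - alpha) ^+ 2 * bound_numerator v alpha k.
  by rewrite /rhs /bound_numerator -/r -/d; field.
have [del_le del_eq] := deletion_bound alpha_ge0 alpha_lt1 G1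
  (etrans (esym (subr_gt0 _ _)) rdpos).
rewrite -/d -/r -/r' -/lhs in del_le del_eq.
have [q_le q_eq] := le_numerator alpha_ge0 alpha_lt1 k_ge0 k_le.
rewrite -/d -/r in q_le q_eq.
have le_rhs := ler_wpM2l (ltW a2) q_le.
split; first by rewrite -(ler_pM2l rdpos) rhsE (le_trans del_le).
move=> conn; have d0 := degree_gt0 v conn G1.
have dpos : 0 < d by rewrite ltr0n.
split=> [eqlr|].
  have eq_del : (r - alpha * d) * lhs =
      (1 - alpha) ^+ 2 * (r * d + quad (alpha_ker alpha) (nbr R v)).
    by apply/eqP; rewrite eq_le del_le eqlr rhsE le_rhs.
  have eq_q : r * d + quad (alpha_ker alpha) (nbr R v) = bound_numerator v alpha k.
    by apply: (mulfI (lt0r_neq0 a2)); rewrite -eq_del eqlr.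
  have [k1|k1] := eqVneq k (d + 1); last first.
    left; apply: iso_complete => //.
    apply: (complete_of_eigenfun alpha_ge0 alpha_lt1 conn).
    have [_] := rayleigh_le_numerator v alpha_ge0; apply; exact: q_eq.
  have clique : forall x y, edge v x -> edge v y -> x != y -> edge x y.
    have [_] := counting_le_numerator v alpha_ge0 alpha_lt1; apply.
    by rewrite -/d -k1.
  have [compl|[[c star] al0 dv]] :=
      complete_or_star alpha_lt1 conn clique (del_eq d0 eq_del).
    by left; apply: iso_complete.
  right; split=> //; first exact: iso_star star.
  by rewrite k1 /d dv.
have complete_eq : (forall x y : G, x != y -> edge x y) -> lhs = rhs.
  move=> compl.
  have dE : d = #|G|%:R - 1.
    rewrite /d degree_complete => [|y]; last exact: compl.
    by rewrite -subn1 natrB.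
  have rE : r = d by rewrite dE /r rho_complete.
  have r'E : r' = d - 1.
    rewrite /r' rho_complete ?del_vertex_gt0// => [|x y xy]; last exact: compl.
    by rewrite dE card_del_vertex -subn1 natrB.
  rewrite /lhs /rhs r'E rE (_ : #|G|%:R = d + 1); last by rewrite dE subrK.
  by field; rewrite -[X in X - _]mul1r -mulrBl mulf_neq0// gt_eqF.
move=> [/complete_iso|[/star_iso[c star] al0 dv k2]]; first exact: complete_eq.
(* a centre of degree 1 has a single leaf, so the star is complete *)
have [vc|vc] := eqVneq v c.
  apply: complete_eq => x y xy; rewrite star -vc.
  have nbrv z : edge v z = (z != v) by rewrite star vc eqxx; case: eqVneq.
  have /eqP/card1P[w Nw] := dv.
  have {}Nw z : (z != v) = (z == w) by have := Nw z; rewrite !inE nbrv.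
  have [xv|/=] := eqVneq x v; first by rewrite -xv eq_sym.
  rewrite Nw => /eqP xw; have [//|] := eqVneq y v.
  by rewrite Nw => /eqP yw; rewrite xw yw eqxx in xy.
have cv : c != v by rewrite eq_sym.
pose c' : del_vertex v := exist _ c cv.
have star' : is_star c' by move=> x y; rewrite -!val_eqE; exact: star.
have card' : #|del_vertex v|%:R = #|G|%:R - 1 :> R.
  by rewrite card_del_vertex -subn1 natrB.
have n2 : 2 <= #|G|%:R :> R by rewrite ler_nat.
rewrite /lhs /rhs /r' /r /d al0 (rho_star _ star) (rho_star _ star') dv k2.
rewrite card' addr0 !sqr_sqrtr; last 2 first.
- by lra.
- by lra.
by rewrite !mul0r !subr0 subrr mul0r add0r mul0r addr0; ring.
Qed.
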